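(* For odd $n\ge 3$ let $Y_n$ be the Sekine quantum group of order $2n^2$, let $\int_{Y_n}$ be its Haar state, and let $\nu=\nu_n$ be the state on $F(Y_n)$ $$\nu=\frac18\left(e^{(0,1)}+e^{(1,0)}+e^{(-1,0)}+e^{(0,-1)}\right)+\frac{1}{2n}\sum_{p,q=1}^nE^{p,q}.$$ There exist constants $c_n$ (depending only on $n$) with $c_n\to1$ as $n\to\infty$ ($n$ odd) such that for every odd $n\ge3$ and every $\alpha>1/20$ for which $k=\alpha n^2$ is a positive integer, $$\frac12 e^{-\alpha\pi^2/2}\leq\left\|\nu^{\star k}-\int_{Y_n}\right\|\leq c_n e^{-\alpha\pi^2/4},$$ where $\pi$ in the exponents is the real number $3.14159\ldots$
   Context: Let $\zeta_n=e^{2\pi i/n}$ and let $\mathbb{Z}_n=\{0,\dots,n-1\}$ with addition modulo $n$. The algebra of functions on $Y_n$ is the $2n^2$-dimensional $\mathrm{C}^*$-algebra $$F(Y_n)=\left(\bigoplus_{i,j\in\mathbb{Z}_n}\mathbb{C}e_{(i,j)}\right)\oplus M_n(\mathbb{C}),$$ where the $e_{(i,j)}$ are the minimal projections of the one-dimensional summands and $E_{i,j}$ ($i,j=1,\dots,n$, indices modulo $n$ with $0\equiv n$) are the matrix units of $M_n(\mathbb{C})$. The comultiplication $\Delta:F(Y_n)\to F(Y_n)\otimes F(Y_n)$ is $$\Delta(e_{(i,j)})=\sum_{\ell,m\in\mathbb{Z}_n}e_{(\ell,m)}\otimes e_{(i-\ell,j-m)}+\frac1n\sum_{\ell,m=1}^n\zeta_n^{i(\ell-m)}E_{\ell,m}\otimes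 E_{\ell+j,m+j},$$ $$\Delta(E_{i,j})=\sum_{\ell,m\in\mathbb{Z}_n}e_{(-\ell,-m)}\otimes\zeta_n^{\ell(i-j)}E_{i-m,j-m}+\sum_{\ell,m\in\mathbb{Z}_n}\zeta_n^{\ell(j-i)}E_{i-m,j-m}\otimes e_{(\ell,m)}.$$ The antipode is $S(e_{(i,j)})=e_{(-i,-j)}$ on the one-dimensional summands and the transpose on $M_n(\mathbb{C})$; the counit is the coefficient of $e_{(0,0)}$. The Haar state is $$\int_{Y_n}\left(\sum_{i,j\in\mathbb{Z}_n}x_{(i,j)}e_{(i,j)}+a\right)=\frac{1}{2n^2}\left(\sum_{i,j\in\mathbb{Z}_n}x_{(i,j)}+n\operatorname{Tr}(a)\right),\qquad a\in M_n(\mathbb{C}).$$ The functionals $e^{(i,j)}$, $E^{i,j}$ form the basis of the dual space of $F(Y_n)$ dual to the basis $\{e_{(i,j)}\}\cup\{E_{i,j}\}$. Convolution powers are $\nu^{\star1}=\nu$, $\nu^{\star(k+1)}=(\nu\otimes\nu^{\star k})\Delta$. The total variation distance between states is $\|\nu-\mu\|=\sup_p|\nu(p)-\mu(p)|$, the supremum over projections $p\in F(Y_n)$ ($p=p^*=p^2$). *)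

(* Defs.v *)
From HB Require Import structures.
From mathcomp Require Import all_boot all_order all_algebra.
From mathcomp Require Import all_classical all_reals all_analysis.
From mathcomp Require Import complex.
Set Implicit Arguments.
Unset Strict Implicit.
Unset Printing Implicit Defensive.
Import Order.TTheory GRing.Theory Num.Theory.
Import numFieldNormedType.Exports.
Local Open Scope classical_set_scope.
Local Open Scope ring_scope.

(* Throughout, all indices live in 'Z_n, so all index arithmetic is modulo n.
   The type 'Z_n is Z/nZ only for 1 < n; it is convertible to
   'I_(Zp_trunc n).+2, the index type of the matrices in M_n(C) below, so that
   the matrix units are indexed modulo n with the index n identified with 0. *)

Definition zeta (R : realType) (n : nat) : R[i] :=
  Complex (cos (2 * pi / n%:R)) (sin (2 * pi / n%:R)).

(* A power of zeta_n whose exponent is a residue class: well defined, and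
   independent of the representative chosen, because zeta_n ^+ n = 1. *)
Definition zetaX (R : realType) (n : nat) (a : 'Z_n) : R[i] := zeta R n ^+ a.

Lemma zeta_unity (R : realType) (n : nat) : (0 < n)%N -> zeta R n ^+ n = 1.
Proof.
move=> n0.
have zX k : zeta R n ^+ k =
    Complex (cos ((2 * pi / n%:R) *+ k)) (sin ((2 * pi / n%:R) *+ k)).
  elim: k => [|k IH]; first by rewrite expr0 !mulr0n cos0 sin0.
  rewrite exprS IH !(mulrS _ k) cosD sinD /zeta.
  by apply/eqP; rewrite eq_complex /= !eqxx /= addrC [X in _ + X]mulrC eqxx.
have e : (2 * pi / n%:R) *+ n = pi *+ 2 :> R.
  by rewrite -mulr_natr mulfVK ?pnatr_eq0 -?lt0n// mulr_natl.
by rewrite zX e cos2pi sin2pi.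
Qed.

(* The algebra F(Y_n); sum, product and scaling are those of the direct
   product of the pointwise functions on Z_n x Z_n and of the n x n matrices. *)
Definition FY (R : realType) (n : nat) : Type :=
  ({ffun 'Z_n * 'Z_n -> R[i]} * 'M[R[i]]_((Zp_trunc n).+2))%type.
HB.instance Definition _ (R : realType) (n : nat) :=
  GRing.PzRing.on (FY R n).
HB.instance Definition _ (R : realType) (n : nat) :=
  GRing.Lmodule.on (FY R n).

Definition star (R : realType) (n : nat) (x : FY R n) : FY R n :=
  ([ffun ij => conjc (x.1 ij)], map_mx conjc x.2^T).

Definition e_ (R : realType) (n : nat) (i j : 'Z_n) : FY R n :=
  ([ffun ij => (ij == (i, j))%:R], 0).

Definition E_ (R : realType) (n : nat) (i j : 'Z_n) : FY R n :=
  (0, delta_mx i j).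

Definition dual_e (R : realType) (n : nat) (i j : 'Z_n) (x : FY R n) : R[i] :=
  x.1 (i, j).

Definition dual_E (R : realType) (n : nat) (i j : 'Z_n) (x : FY R n) : R[i] :=
  x.2 i j.

(* Labels of the basis of F(Y_n): inl (i, j) for e_(i,j), inr (i, j) for
   E_{i,j}. *)
Definition blabel (n : nat) : Type := ('Z_n * 'Z_n + 'Z_n * 'Z_n)%type.
HB.instance Definition _ (n : nat) := Finite.on (blabel n).

Definition bvec (R : realType) (n : nat) (b : blabel n) : FY R n :=
  match b with inl ij => e_ R ij.1 ij.2 | inr ij => E_ R ij.1 ij.2 end.

Definition bcoord (R : realType) (n : nat) (b : blabel n) : FY R n -> R[i] :=
  match b with
  | inl ij => @dual_e R n ij.1 ij.2
  | inr ij => @dual_E R n ij.1 ij.2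
  end.

(* F(Y_n) (x) F(Y_n), as the coordinates with respect to the basis of the
   tensors of two basis vectors. *)
Definition FY2 (R : realType) (n : nat) : Type :=
  {ffun blabel n * blabel n -> R[i]}.
HB.instance Definition _ (R : realType) (n : nat) :=
  GRing.Lmodule.on (FY2 R n).

Definition tens (R : realType) (n : nat) (x y : FY R n) : FY2 R n :=
  [ffun bc => bcoord bc.1 x * bcoord bc.2 y].

(* The functional nu (x) mu on F(Y_n) (x) F(Y_n). *)
Definition tens_fun (R : realType) (n : nat) (nu mu : FY R n -> R[i])
    (t : FY2 R n) : R[i] :=
  \sum_(b : blabel n) \sum_(c : blabel n) t (b, c) * (nu (bvec R b) * mu (bvec R c)).

Definition Delta_e (R : realType) (n : nat) (i j : 'Z_n) : FY2 R n :=
  \sum_(l : 'Z_n) \sum_(m : 'Z_n) tens (e_ R l m) (e_ R (i - l) (j - m))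
  + n%:R^-1 *: \sum_(l : 'Z_n) \sum_(m : 'Z_n)
      zetaX R (i * (l - m)) *: tens (E_ R l m) (E_ R (l + j) (m + j)).

Definition Delta_E (R : realType) (n : nat) (i j : 'Z_n) : FY2 R n :=
  \sum_(l : 'Z_n) \sum_(m : 'Z_n)
      tens (e_ R (- l) (- m)) (zetaX R (l * (i - j)) *: E_ R (i - m) (j - m))
  + \sum_(l : 'Z_n) \sum_(m : 'Z_n)
      tens (zetaX R (l * (j - i)) *: E_ R (i - m) (j - m)) (e_ R l m).

Definition Delta (R : realType) (n : nat) (x : FY R n) : FY2 R n :=
  \sum_(i : 'Z_n) \sum_(j : 'Z_n) dual_e i j x *: Delta_e R i j
  + \sum_(i : 'Z_n) \sum_(j : 'Z_n) dual_E i j x *: Delta_E R i j.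

Definition conv (R : realType) (n : nat) (nu mu : FY R n -> R[i]) :
  FY R n -> R[i] := fun x => tens_fun nu mu (Delta x).

(* The k-th convolution power, for k >= 1 only (k = 0 returns nu again). *)
Definition convpow (R : realType) (n : nat) (nu : FY R n -> R[i]) (k : nat) :
  FY R n -> R[i] := iter k.-1 (conv nu) nu.

Definition haar (R : realType) (n : nat) (x : FY R n) : R[i] :=
  (2 * n%:R ^+ 2)^-1 *
  (\sum_(i : 'Z_n) \sum_(j : 'Z_n) x.1 (i, j) + n%:R * \tr x.2).

Definition projection (R : realType) (n : nat) (p : FY R n) : Prop :=
  p = star p /\ p = p * p.

(* The supremum is taken in the extended reals, so that it is meaningful
   without a boundedness side condition. *)
Definition tv_dist (R : realType) (n : nat) (nu mu : FY R n -> R[i]) : \bar R :=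
  ereal_sup [set (ComplexField.Normc.normc (nu p - mu p))%:E | p in @projection R n].

Definition nu_walk (R : realType) (n : nat) (x : FY R n) : R[i] :=
  8%:R^-1 * (dual_e 0 1 x + dual_e 1 0 x + dual_e (-1) 0 x + dual_e 0 (-1) x)
  + (2 * n%:R)^-1 * \sum_(p : 'Z_n) \sum_(q : 'Z_n) dual_E p q x.

Lemma bcoord_bvec (R : realType) (n : nat) (b c : blabel n) :
  bcoord b (bvec R c) = (b == c)%:R.
Proof.
case: b c => [[i j]|[i j]] [[k l]|[k l]]; rewrite /= /dual_e /dual_E /=.
- by rewrite ffunE.
- by rewrite ffunE.
- by rewrite mxE.
- by rewrite mxE.
Qed.

Lemma bcoord_is_scalar (R : realType) (n : nat) (b : blabel n) :
  scalar (@bcoord R n b).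
Proof.
case: b => [[i j]|[i j]] k x y; rewrite /= /dual_e /dual_E /=.
  by rewrite !ffunE.
by rewrite !mxE.
Qed.
HB.instance Definition _ (R : realType) (n : nat) (b : blabel n) :=
  GRing.isLinear.Build R[i] (FY R n) R[i] *%R (@bcoord R n b)
    (bcoord_is_scalar b).

Lemma bcoord_inj (R : realType) (n : nat) (x y : FY R n) :
  (forall b, bcoord b x = bcoord b y) -> x = y.
Proof.
case: x y => [f a] [g c] xy; congr (_, _).
  by apply/ffunP => -[i j]; have := xy (inl (i, j)).
by apply/matrixP => i j; have := xy (inr (i, j)).
Qed.

Lemma bvec_sum (R : realType) (n : nat) (x : FY R n) :
  x = \sum_(b : blabel n) bcoord b x *: bvec R b.
Proof.
apply: bcoord_inj => c; rewrite linear_sum (bigD1 c) //= linearZ /=.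
rewrite bcoord_bvec eqxx mulr1 big1 ?addr0 // => b bc.
by rewrite linearZ /= bcoord_bvec eq_sym (negbTE bc) mulr0.
Qed.

Lemma tens_funE (R : realType) (n : nat) (nu mu : {scalar FY R n})
    (x y : FY R n) : tens_fun nu mu (tens x y) = nu x * mu y.
Proof.
rewrite {2}[x]bvec_sum {2}[y]bvec_sum !linear_sum mulr_suml.
apply: eq_bigr => b _; rewrite mulr_sumr; apply: eq_bigr => c _.
by rewrite ffunE !linearZ /= mulrACA.
Qed.

Lemma DeltaE (R : realType) (n : nat) (x : FY R n) :
  Delta x = \sum_(b : blabel n) bcoord b x *:
    match b with inl ij => Delta_e R ij.1 ij.2 | inr ij => Delta_E R ij.1 ij.2 end.
Proof. by rewrite big_sumType /= /Delta !pair_bigA. Qed.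

Lemma Delta_is_linear (R : realType) (n : nat) : linear (@Delta R n).
Proof.
move=> k x y; rewrite !DeltaE scaler_sumr -big_split; apply: eq_bigr => b _.
by rewrite linearP scalerDl scalerA.
Qed.
HB.instance Definition _ (R : realType) (n : nat) :=
  GRing.isLinear.Build R[i] (FY R n) (FY2 R n) *:%R (@Delta R n)
    (@Delta_is_linear R n).

Lemma Delta_bvec (R : realType) (n : nat) (b : blabel n) :
  Delta (bvec R b) =
    match b with inl ij => Delta_e R ij.1 ij.2 | inr ij => Delta_E R ij.1 ij.2 end.
Proof.
rewrite DeltaE (bigD1 b) //= bcoord_bvec eqxx scale1r big1 ?addr0 // => c cb.
by rewrite bcoord_bvec (negbTE cb) scale0r.
Qed.

(* Main.v *)
From HB Require Import structures.
Require Import Defs.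
From mathcomp Require Import all_boot all_order all_algebra.
From mathcomp Require Import all_classical all_reals all_analysis.
From mathcomp Require Import complex ring lra zify.
Set Implicit Arguments.
Unset Strict Implicit.
Unset Printing Implicit Defensive.
Import Order.TTheory GRing.Theory Num.Theory.
Import numFieldNormedType.Exports.
Local Open Scope classical_set_scope.
Local Open Scope ring_scope.

(* Consider the functionals on F(Y_n) whose restriction to the one-dimensional
   summands is the inverse Fourier transform of a function P on Z_n x Z_n, and
   whose value at E_{i,j} is g(i - j) / n. They are closed under convolution,
   and the walk and the Haar state are of this form; on the line {v = 0} the
   pair (P, g) multiplies like an element of the group algebra of Z/2 over each
   u, so P + g and P - g are multiplicative there, and P is multiplicative off
   that line. With a_u = cos(2 pi u / n) the walk has P + g = (3 + a_u) / 4 and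
   P - g = (a_u - 1) / 4 on the line and P = (a_u + a_v) / 4 off it.

   Upper bound: as 1 is sent to 0 by the difference with the Haar state, a
   projection p may be replaced by half of the reflection 2 p - 1, and
   Cauchy-Schwarz with Plancherel bounds the distance by the l^2 norm of (P, g).
   Only the powers of A_u = (3 + a_u) / 4 matter, and Jordan's inequality makes
   them summable fast enough for alpha > 1/20; what remains is O(n^2 4^-k).

   Lower bound: the unitary with spectral projections p_s (s in Z_n) built from
   the first coordinate and the cyclic shift carries a classical lazy random
   walk on Z_n with eigenvalues A_u^k, so some sum of p_s witnesses a distance
   of at least A_1^k / 2, and A_1 >= exp(- pi^2 / (2 n^2)). *)

(** * Bounds on sine, cosine, exponential and pi *)

Section RealBounds.
Context {R : realType}.
Implicit Types x y : R.

(** Each Taylor bound below applies this to the difference of its two sides, whose derivative is an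
    earlier bound. *)
Lemma ge0_of_derive (f df : R -> R) : f 0 = 0 ->
  (forall x, is_derive x 1 f (df x)) -> (forall x, 0 <= x -> 0 <= df x) ->
  forall x, 0 <= x -> 0 <= f x.
Proof.
move=> f0 fdf df0 x x0.
have fc : continuous f.
  by move=> y; apply/differentiable_continuous/derivable1_diffP; case: (fdf y).
have [|c /itvP cx] := @MVT_segment _ f df 0 x x0 (fun y _ => fdf y).
  exact: continuous_subspaceT.
by rewrite f0 !subr0 => ->; rewrite mulr_ge0 // df0 // cx.
Qed.

Lemma sin_le_id x : 0 <= x -> sin x <= x.
Proof.
move=> x0; rewrite -subr_ge0.
apply: (@ge0_of_derive (fun x => x - sin x) (fun x => 1 - cos x)) => //.
by rewrite sin0 subrr.
Qed.

Lemma cos_ge_taylor2 x : 0 <= x -> 1 - x ^+ 2 / 2 <= cos x.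
Proof.
move=> x0; rewrite -subr_ge0.
apply: (@ge0_of_derive (fun x => cos x - (1 - x ^+ 2 / 2)) (fun x => x - sin x)) x0.
- by rewrite cos0; ring.
- move=> y; apply: is_derive_eq; rewrite /GRing.scale /=; by field.
- by move=> y y0; rewrite subr_ge0 sin_le_id.
Qed.

Lemma sin_ge_taylor3 x : 0 <= x -> x - x ^+ 3 / 6 <= sin x.
Proof.
move=> x0; rewrite -subr_ge0.
apply: (@ge0_of_derive (fun x => sin x - (x - x ^+ 3 / 6))
  (fun x => cos x - (1 - x ^+ 2 / 2))) x0.
- by rewrite sin0; ring.
- move=> y; apply: is_derive_eq; rewrite /GRing.scale /=; by field.
- by move=> y y0; rewrite subr_ge0 cos_ge_taylor2.
Qed.

Lemma cos_le_taylor4 x : 0 <= x -> cos x <= 1 - x ^+ 2 / 2 + x ^+ 4 / 24.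
Proof.
move=> x0; rewrite -subr_ge0.
apply: (@ge0_of_derive (fun x => 1 - x ^+ 2 / 2 + x ^+ 4 / 24 - cos x)
  (fun x => sin x - (x - x ^+ 3 / 6))) x0.
- by rewrite cos0; ring.
- move=> y; apply: is_derive_eq; rewrite /GRing.scale /=; by field.
- by move=> y y0; rewrite subr_ge0 sin_ge_taylor3.
Qed.

Lemma sin_le_taylor5 x : 0 <= x -> sin x <= x - x ^+ 3 / 6 + x ^+ 5 / 120.
Proof.
move=> x0; rewrite -subr_ge0.
apply: (@ge0_of_derive (fun x => x - x ^+ 3 / 6 + x ^+ 5 / 120 - sin x)
  (fun x => 1 - x ^+ 2 / 2 + x ^+ 4 / 24 - cos x)) x0.
- by rewrite sin0; ring.
- move=> y; apply: is_derive_eq; rewrite /GRing.scale /=; by field.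
- by move=> y y0; rewrite subr_ge0 cos_le_taylor4.
Qed.

(** [30 * 24] is 6!. The lower bound of degree 2 is too weak for [eigA1_ge], as 1 - y lies below
    exp(- y). *)
Lemma cos_ge_taylor6 x : 0 <= x ->
  1 - x ^+ 2 / 2 + x ^+ 4 / 24 - x ^+ 6 / (30 * 24) <= cos x.
Proof.
move=> x0; rewrite -subr_ge0.
apply: (@ge0_of_derive
  (fun x => cos x - (1 - x ^+ 2 / 2 + x ^+ 4 / 24 - x ^+ 6 / (30 * 24)))
  (fun x => x - x ^+ 3 / 6 + x ^+ 5 / 120 - sin x)) x0.
- by rewrite cos0; ring.
- move=> y; apply: is_derive_eq; rewrite /GRing.scale /=; by field.
- by move=> y y0; rewrite subr_ge0 sin_le_taylor5.
Qed.

Lemma expR_ge_taylor2 x : 0 <= x -> 1 + x + x ^+ 2 / 2 <= expR x.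
Proof.
move=> x0; rewrite -subr_ge0.
apply: (@ge0_of_derive (fun x => expR x - (1 + x + x ^+ 2 / 2))
  (fun x => expR x - (1 + x))) x0.
- by rewrite expR0; ring.
- move=> y; apply: is_derive_eq; rewrite /GRing.scale /=; by field.
- by move=> y y0; rewrite subr_ge0 expR_ge1Dx.
Qed.

(** At pi / 2 the quartic bound on cosine reads y^2 - 48 y + 384 >= 0 with y = pi^2; pi < 4 rules
    out the larger root, and the smaller one is just below 203 / 20. *)
Lemma pi_sqr_le : pi ^+ 2 <= 203 / 20 :> R.
Proof.
have := @cos_le_taylor4 (pi / 2) (divr_ge0 (pi_ge0 R) (ler0n _ 2)).
rewrite cos_pihalf.
have p4 : pi < 4 :> R by have := @pihalf_lt2 R; lra.
have p0 := pi_gt0 R.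
set y : R := pi ^+ 2.
have y16 : y <= 16 by rewrite /y; nra.
have -> : (pi / 2) ^+ 2 = y / 4 :> R by rewrite /y; field.
have -> : (pi / 2) ^+ 4 = y ^+ 2 / 16 :> R by rewrite /y; field.
move=> h; rewrite leNgt; apply/negP => yl.
by nra.
Qed.

(* Jordan's inequality: by the mean value theorem the slope of [sin] on
   [[0, x]] dominates its slope on [[x, pi / 2]]. *)
Lemma jordan_sin x : 0 <= x <= pi / 2 -> 2 * x / pi <= sin x.
Proof.
move=> /andP[x0 xp].
have p0 := pi_gt0 R.
have sc : forall a b : R, {within `[a, b], continuous (@sin R)}.
  by move=> a b; apply: continuous_subspaceT; exact: continuous_sin.
have [c /itvP ch] := @MVT_segment _ (@sin R) (@cos R) 0 x x0
  (fun y _ => is_derive_sin y) (sc _ _).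
have [d /itvP dh] := @MVT_segment _ (@sin R) (@cos R) x (pi / 2) xp
  (fun y _ => is_derive_sin y) (sc _ _).
rewrite sin0 sin_pihalf !subr0 => hd hc.
have cd : cos d <= cos c.
  have [->//|cd] := eqVneq c d.
  have cltd : c < d by rewrite lt_neqAle cd; apply: (@le_trans _ _ x); rewrite ?ch ?dh.
  rewrite ltW // ltr_cos // in_itv /=.
    by rewrite ch /= (@le_trans _ _ x) ?ch //; lra.
  by rewrite (@le_trans _ _ x) ?dh //= (@le_trans _ _ (pi / 2)) ?dh //; lra.
rewrite ler_pdivrMr //.
have h : x * (1 - sin x) <= sin x * (pi / 2 - x).
  rewrite hd hc; have -> : x * (cos d * (pi / 2 - x)) = cos d * (x * (pi / 2 - x)) by ring.
  have -> : cos c * x * (pi / 2 - x) = cos c * (x * (pi / 2 - x)) by ring.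
  by rewrite ler_wpM2r // mulr_ge0 // subr_ge0.
lra.
Qed.

End RealBounds.

(** * Powers of the eigenvalues of the lazy walk on Z_n *)

Section Eigenvalues.
Context {R : realType}.
Implicit Types (x y alpha : R) (n u k : nat).

Definition rootcos n u : R := cos ((2 * pi / n%:R) *+ u).

(* The eigenvalues of the walk on Z_n that stays put with probability 3/4 and
   moves by 1 or -1 with probability 1/8 each. *)
Definition eigA n u : R := (3 + rootcos n u) / 4.

Lemma eigA_ge0 n u : 0 <= eigA n u.
Proof. by rewrite /eigA /rootcos; have := cos_geN1 ((2 * pi / n%:R : R) *+ u); lra. Qed.

Lemma rootcosC n u : (0 < n)%N -> (u <= n)%N -> rootcos n (n - u) = rootcos n u.
Proof.
move=> n0 un; rewrite /rootcos mulrnBr // -[_ *+ n]mulr_natr divfK ?pnatr_eq0 -?lt0n //.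
by rewrite mulr_natl addrC cosD2pi cosN.
Qed.

(** Write cos (2 pi t) = 1 - 2 sin^2 (pi t) with t = u / n and apply Jordan's inequality to the
    sine. *)
Lemma rootcos_le n u : (0 < n)%N -> (2 * u <= n)%N ->
  rootcos n u <= 1 - 8 * (u%:R / n%:R) ^+ 2.
Proof.
move=> n0 un; have p0 := pi_gt0 R.
have nR : (0 : R) < n%:R by rewrite ltr0n.
set t : R := u%:R / n%:R.
have t0 : 0 <= t by rewrite divr_ge0 // ler0n.
have t1 : t <= 1 / 2.
  by rewrite ler_pdivrMr // mulrAC ler_pdivlMr // mul1r mulrC -natrM ler_nat.
rewrite /rootcos; have -> : (2 * pi / n%:R : R) *+ u = (pi * t) *+ 2.
  by rewrite -mulr_natr /t -mulr_natr; field; rewrite gt_eqF.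
rewrite cos_mulr2n cos2sin2.
have h : 2 * t <= sin (pi * t).
  have := @jordan_sin R (pi * t).
  rewrite (_ : 2 * (pi * t) / pi = 2 * t); last first.
    by rewrite mulrA mulrAC mulfK // gt_eqF.
  apply; apply/andP; split; first by rewrite mulr_ge0 // ltW.
  by rewrite ler_wpM2l ?(ltW p0) // -[2^-1]mul1r.
by nra.
Qed.

Lemma angle_sqr_le n : (3 <= n)%N -> (2 * pi / n%:R) ^+ 2 <= 23 / 5 :> R.
Proof.
move=> n3; have p0 := pi_gt0 R; have p2 := @pi_sqr_le R.
have nR : (3 : R) <= n%:R by rewrite ler_nat.
rewrite expr_div_n exprMn ler_pdivrMr; last by rewrite exprn_gt0 //; lra.
by nra.
Qed.

(** [rootcos_le] gives only 8 in place of pi^2, which would spoil the exponential rate. Here t^2 <=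
    23 / 5 < 6 makes t^4 / 24 at most t^2 / 4. *)
Lemma rootcos1_le n : (3 <= n)%N -> rootcos n 1 <= 1 - pi ^+ 2 / n%:R ^+ 2.
Proof.
move=> n3; have := @angle_sqr_le n n3.
have n0 : n%:R != 0 :> R by rewrite pnatr_eq0; lia.
have -> : pi ^+ 2 / n%:R ^+ 2 = (2 * pi / n%:R) ^+ 2 / 4 :> R by field.
rewrite /rootcos mulr1n; set t := 2 * pi / _ => t2.
have t0 : 0 <= t by rewrite divr_ge0 ?ler0n // mulr_ge0 // pi_ge0.
have := @cos_le_taylor4 R t t0.
have -> : t ^+ 4 = (t ^+ 2) ^+ 2 by rewrite -exprM.
have := sqr_ge0 t.
by nra.
Qed.

(** With y = pi^2 / (2 n^2), Taylor polynomials bound [eigA n 1] and exp(y) from below, and their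
    product is at least 1. *)
Lemma eigA1_ge n : (3 <= n)%N ->
  expR (- (pi ^+ 2 / (2 * n%:R ^+ 2))) <= eigA n 1.
Proof.
move=> n3; have := @angle_sqr_le n n3.
have n0 : n%:R != 0 :> R by rewrite pnatr_eq0; lia.
have -> : pi ^+ 2 / (2 * n%:R ^+ 2) = (2 * pi / n%:R) ^+ 2 / 8 :> R by field.
rewrite /eigA /rootcos mulr1n; set t := 2 * pi / _ => t2.
have t0 : 0 <= t by rewrite divr_ge0 ?ler0n // mulr_ge0 // pi_ge0.
have := @cos_ge_taylor6 R t t0.
have -> : t ^+ 4 = (t ^+ 2) ^+ 2 by rewrite -exprM.
have -> : t ^+ 6 = (t ^+ 2) ^+ 3 by rewrite -exprM.
move: (sqr_ge0 t) t2; set z := t ^+ 2 => z0 z1 hc.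
have [y hy] : {y | z = 8 * y} by exists (z / 8); field.
have y0 : 0 <= y by lra.
have y1 : y <= 23 / 40 by lra.
have -> : z / 8 = y by lra.
have hA : 1 - y + 2 / 3 * y ^+ 2 - 8 / 45 * y ^+ 3 <= (3 + cos t) / 4.
  by move: hc; rewrite hy !exprMn; lra.
have P0 : 0 < 1 - y + 2 / 3 * y ^+ 2 - 8 / 45 * y ^+ 3.
  rewrite (_ : _ - _ = 1 - y + y ^+ 2 * (2 / 3 - 8 / 45 * y)); last by ring.
  by apply: ltr_wpDr; [rewrite mulr_ge0 ?sqr_ge0 //|]; lra.
have q0 : 0 < 1 + y + y ^+ 2 / 2 by have := sqr_ge0 y; lra.
rewrite expRN invf_ple ?posrE ?expR_gt0 ?(lt_le_trans P0 hA) //.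
apply: le_trans (expR_ge_taylor2 y0).
rewrite invf_ple ?posrE ?(lt_le_trans P0 hA) //.
apply: le_trans hA; rewrite -div1r ler_pdivrMr //.
(* This is the product of the two Taylor polynomials minus 1. *)
have : 0 <= y ^+ 2 * (1 / 6 - y / 90 + y ^+ 2 * (7 / 45 - 4 / 45 * y)).
  rewrite mulr_ge0 ?sqr_ge0 //; have : 0 <= y ^+ 2 * (7 / 45 - 4 / 45 * y).
    by rewrite mulr_ge0 ?sqr_ge0 //; lra.
  lra.
by lra.
Qed.

Lemma rootcos_lt1 n u : (0 < u < n)%N -> rootcos n u < 1.
Proof.
move=> /andP[u0 un].
have key v : (0 < v)%N -> (2 * v <= n)%N -> rootcos n v < 1.
  move=> v0 vn; apply: le_lt_trans (rootcos_le _ vn) _; first by lia.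
  have : 0 < (v%:R / n%:R : R) ^+ 2 by rewrite exprn_gt0 // divr_gt0 // ltr0n; lia.
  by lra.
have [?|?] := leqP (2 * u) n; first exact: key.
by rewrite -(@rootcosC n u); [apply: key| |]; lia.
Qed.

(* For [u >= 2] the exponent is [4 alpha u ^ 2], which exceeds
   [alpha pi ^ 2 / 2] by at least [alpha (437 / 40 + 20 (u - 2))], and
   [alpha > 1 / 20]; the rates 3/5 and 2/5 bound exp(-437/800) and exp(-1). *)
Lemma eigA_pow_le n u k alpha : (3 <= n)%N -> 1 / 20 < alpha ->
  k%:R = alpha * n%:R ^+ 2 -> (0 < u)%N -> (2 * u <= n)%N ->
  eigA n u ^+ (2 * k) <= expR (- (alpha * pi ^+ 2 / 2)) *
    (if u == 1 then 1 else 3 / 5 * (2 / 5) ^+ (u - 2)).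
Proof.
move=> n3 a20 kE u0 un.
have n0 : n%:R != 0 :> R by rewrite pnatr_eq0; lia.
have powle y : eigA n u <= 1 - y -> eigA n u ^+ (2 * k) <= expR (- (2 * alpha * (y * n%:R ^+ 2))).
  move=> hy; have -> : - (2 * alpha * (y * n%:R ^+ 2)) = (- y) * (2 * k)%:R.
    by rewrite natrM kE; ring.
  rewrite expRM_natr lerXn2r ?nnegrE ?expR_ge0 ?eigA_ge0 //.
  by apply: le_trans hy _; exact: expR_ge1Dx.
have [u1|u1] := eqVneq u 1.
  rewrite mulr1; apply: le_trans (powle (pi ^+ 2 / n%:R ^+ 2 / 4) _) _.
    by rewrite u1 /eigA; have := rootcos1_le n3; lra.
  by rewrite ler_expR le_eqVlt; apply/orP; left; apply/eqP; field.
apply: le_trans (powle (2 * (u%:R / n%:R) ^+ 2) _) _.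
  by rewrite /eigA; have := @rootcos_le n u ltac:(lia) un; lra.
have -> : 2 * alpha * (2 * (u%:R / n%:R) ^+ 2 * n%:R ^+ 2) = alpha * (4 * u%:R ^+ 2).
  by field.
have -> : - (alpha * (4 * u%:R ^+ 2)) = - (alpha * pi ^+ 2 / 2)
   + - (alpha * (4 * u%:R ^+ 2 - pi ^+ 2 / 2)) by ring.
rewrite expRD ler_wpM2l ?expR_ge0 //.
have [v uE] : {v | u = (v + 2)%N} by exists (u - 2)%N; lia.
rewrite uE addnK natrD.
have vR : (0 : R) <= v%:R by rewrite ler0n.
have p2 := @pi_sqr_le R.
have h : 437 / 800 + v%:R <= alpha * (4 * (v%:R + 2) ^+ 2 - pi ^+ 2 / 2).
  (* [pi_sqr_le] gives 16 - pi^2 / 2 >= 437 / 40, and 4 v^2 + 16 v >= 20 v for a natural number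
     v. *)
  have h0 : 437 / 40 + 20 * v%:R <= 4 * (v%:R + 2) ^+ 2 - pi ^+ 2 / 2 :> R.
    have : (v%:R : R) <= v%:R ^+ 2.
      by rewrite -natrX ler_nat; case: (v) => // w; rewrite expnS leq_pmulr // expn_gt0.
    by lra.
  apply: le_trans (_ : 1 / 20 * (4 * (v%:R + 2) ^+ 2 - pi ^+ 2 / 2) <= _); first lra.
  by rewrite ler_wpM2r //; lra.
apply: le_trans (_ : expR (- (437 / 800 + v%:R)) <= _); first by rewrite ler_expR lerN2.
rewrite opprD expRD ler_pM ?expR_ge0 //.
  rewrite expRN invf_ple ?posrE ?expR_gt0 //.
  apply: le_trans (@expR_ge_taylor2 R (437 / 800) ltac:(lra)).
  lra.
have -> : - v%:R = (-1) * v%:R :> R by ring.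
rewrite expRM_natr lerXn2r ?nnegrE ?expR_ge0 //.
rewrite expRN invf_ple ?posrE ?expR_gt0 //.
apply: le_trans (@expR_ge_taylor2 R 1 ltac:(lra)).
lra.
Qed.

(** The geometric series with first term 3/5 and ratio 2/5 sums to 1, and u = 1 contributes another
    1. *)
Lemma sum_weight_le n :
  \sum_(1 <= u < n) (if u == 1 then 1 else 3 / 5 * (2 / 5) ^+ (u - 2)) <= 2 :> R.
Proof.
case: n => [|[|n]]; [by rewrite big_geq|by rewrite big_geq|].
have -> : \sum_(1 <= u < n.+2) (if u == 1 then 1 else 3 / 5 * (2 / 5) ^+ (u - 2))
    = 2 - (2 / 5) ^+ n :> R.
  elim: n => [|n IH]; first by rewrite big_nat1 /= expr0; ring.
  by rewrite big_nat_recr //= IH subn2 /= exprS; field.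
by rewrite gerBl exprn_ge0 //; lra.
Qed.

(** By the symmetry of u and n - u each term is bounded by the weight of one of the two, so twice
    the total weight 2 suffices. *)
Lemma sum_eigA_pow_le n k alpha : (3 <= n)%N -> 1 / 20 < alpha ->
  k%:R = alpha * n%:R ^+ 2 ->
  \sum_(1 <= u < n) eigA n u ^+ (2 * k) <= 4 * expR (- (alpha * pi ^+ 2 / 2)).
Proof.
move=> n3 a20 kE; set E := expR _.
pose w u : R := if u == 1 then 1 else 3 / 5 * (2 / 5) ^+ (u - 2).
have w0 u : 0 <= w u by rewrite /w; case: ifP => // _; rewrite mulr_ge0 ?exprn_ge0 //; lra.
have E0 : 0 <= E by exact: expR_ge0.
apply: le_trans (_ : \sum_(1 <= u < n) (E * w u + E * w (n - u)%N) <= _).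
  rewrite !big_nat; apply: ler_sum => u /andP[u0 un].
  have [un2|un2] := leqP (2 * u) n.
    apply: le_trans (eigA_pow_le n3 a20 kE u0 un2) _.
    by rewrite lerDl mulr_ge0.
  have -> : eigA n u = eigA n (n - u) by rewrite /eigA rootcosC //; lia.
  apply: le_trans (eigA_pow_le n3 a20 kE _ _) _; [lia|lia|].
  by rewrite lerDr mulr_ge0.
rewrite big_split /= [X in _ + X]big_nat_rev /=.
under [X in _ + X]eq_big_nat => u /andP[u0 un].
  have -> : (n - (1 + n - u.+1) = u)%N by lia.
  over.
have := sum_weight_le n; rewrite -/w -mulr_sumr => h.
by have : E * \sum_(1 <= u < n) w u <= E * 2 := ler_wpM2l E0 h; lra.
Qed.

(** Since exp(- pi^2 / (2 n^2)) >= 5/12, each factor 1/4 splits off one such exponential and leaves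
    3/5; the k-th power of 3/5 then outweighs n^4. *)
Lemma quarter_pow_le n k alpha : (3 <= n)%N -> 1 / 20 < alpha ->
  k%:R = alpha * n%:R ^+ 2 ->
  3 * n%:R ^+ 2 * (1 / 4) ^+ k <=
    4 * expR (- (alpha * pi ^+ 2 / 2)) * (1350 / n%:R ^+ 2).
Proof.
move=> n3 a20 kE; have p2 := @pi_sqr_le R.
have nR : (3 : R) <= n%:R by rewrite ler_nat.
have n2 : 9 <= n%:R ^+ 2 :> R by nra.
have h1 : (1 / 4 : R) ^+ k <= expR (- (alpha * pi ^+ 2 / 2)) * (3 / 5) ^+ k.
  have e : - (alpha * pi ^+ 2 / 2) = - (pi ^+ 2 / 2 / n%:R ^+ 2) * k%:R :> R.
    by rewrite kE; field; lra.
  rewrite e expRM_natr -exprMn lerXn2r ?nnegrE ?mulr_ge0 ?expR_ge0 //; try lra.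
  have : 1 - 7 / 12 <= expR (- (pi ^+ 2 / 2 / n%:R ^+ 2)) :> R.
    apply: le_trans (expR_ge1Dx _).
    by rewrite lerD2l lerN2 ler_pdivrMr; lra.
  by lra.
have h2 : 2 / 9 * k%:R ^+ 2 <= (5 / 3 : R) ^+ k.
  (* The left side is the binomial expansion of (1 + 2/3)^k up to second order. *)
  have : 1 + 4 / 9 * k%:R + 2 / 9 * k%:R ^+ 2 <= (5 / 3 : R) ^+ k.
    elim: (k) => [|m IH]; first by rewrite expr0; lra.
    rewrite [leRHS]exprS -(natr1 m); have m0 : (0 : R) <= m%:R by rewrite ler0n.
    have : (m%:R : R) <= m%:R ^+ 2.
      by rewrite -natrX ler_nat; case: (m) => // w; rewrite expnS leq_pmulr // expn_gt0.
    by lra.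
  by have := ler0n R k; lra.
have h3 : (3 / 5 : R) ^+ k * (5 / 3) ^+ k = 1.
  by rewrite -exprMn (_ : 3 / 5 * (5 / 3) = 1) ?expr1n //; field.
have q0 : 0 <= (3 / 5 : R) ^+ k by rewrite exprn_ge0 //; lra.
have h4 : (3 / 5 : R) ^+ k * (2 / 9 * k%:R ^+ 2) <= 1 by rewrite -[leRHS]h3 ler_wpM2l.
(* 1800 is 9/2 times 400, from [h4] and alpha^2 >= 1/400; at the end 3 * 1800 = 4 * 1350. *)
have h5 : (3 / 5 : R) ^+ k * n%:R ^+ 4 <= 1800.
  have a0 : 1 / 400 <= alpha ^+ 2 by nra.
  have : 0 <= (3 / 5 : R) ^+ k * n%:R ^+ 4 by rewrite mulr_ge0 // exprn_ge0 // ler0n.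
  move: h4; rewrite kE (_ : (3 / 5) ^+ k * (2 / 9 * (alpha * n%:R ^+ 2) ^+ 2)
    = 2 / 9 * alpha ^+ 2 * ((3 / 5) ^+ k * n%:R ^+ 4)); last by ring.
  by nra.
have n20 : n%:R ^+ 2 != 0 :> R by lra.
rewrite [leRHS]mulrA ler_pdivlMr; last lra.
have E0 := expR_ge0 (- (alpha * pi ^+ 2 / 2)).
move: h1 E0; set E := expR _ => h1 E0.
apply: le_trans (_ : 3 * n%:R ^+ 2 * (E * (3 / 5) ^+ k) * n%:R ^+ 2 <= _).
  by rewrite ler_wpM2r ?ler_wpM2l //; lra.
rewrite (_ : 3 * n%:R ^+ 2 * (E * (3 / 5) ^+ k) * n%:R ^+ 2 =
  3 * E * ((3 / 5) ^+ k * n%:R ^+ 4)); last by ring.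
by have : E * ((3 / 5) ^+ k * n%:R ^+ 4) <= E * 1800 := ler_wpM2l E0 h5; lra.
Qed.

End Eigenvalues.

(** * Fourier analysis on Z_n x Z_n *)

Section Characters.
Local Open Scope complex_scope.
Context {R : realType} {n : nat} (n1 : (1 < n)%N).
Local Notation C := R[i].
Local Notation Z := 'Z_n.
Local Notation Z2 := ('Z_n * 'Z_n)%type.
Implicit Types (a b c : Z) (w p q : Z2).

Let n0 : (0 < n)%N := ltnW n1.

Lemma ltn_Z a : (a < n)%N.
Proof. by rewrite -[ltnRHS](Zp_cast n1). Qed.

Lemma natrZ_neq0 : n%:R != 0 :> C.
Proof. by rewrite pnatr_eq0 -lt0n. Qed.

Lemma zetaX_mod (m : nat) : zeta R n ^+ (m %% n) = zeta R n ^+ m.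
Proof. by rewrite expr_mod // zeta_unity. Qed.

Lemma zetaXD a b : zetaX R (a + b) = zetaX R a * zetaX R b.
Proof.
have -> : zetaX R (a + b) = zeta R n ^+ ((a + b)%N %% n).
  by congr (_ ^+ _); congr (_ %% _)%N; exact: Zp_cast.
by rewrite zetaX_mod exprD.
Qed.

Lemma zetaX0 : zetaX R (0 : Z) = 1. Proof. exact: expr0. Qed.

Lemma zetaX_mulN a : zetaX R a * zetaX R (- a) = 1.
Proof. by rewrite -zetaXD subrr zetaX0. Qed.

Lemma zetaXE a : zetaX R a =
  Complex (rootcos n a) (sin ((2 * pi / n%:R) *+ a)).
Proof.
rewrite /zetaX /rootcos; elim: (nat_of_ord a) => [|k IH].
  by rewrite expr0 !mulr0n cos0 sin0.
rewrite exprS IH !(mulrS _ k) cosD sinD /zeta.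
by apply/eqP; rewrite eq_complex /= !eqxx /= addrC [X in _ + X]mulrC eqxx.
Qed.

Lemma conjc_zetaX a : conjc (zetaX R a) = zetaX R (- a).
Proof.
have h : zetaX R a * conjc (zetaX R a) = 1.
  rewrite zetaXE /rootcos; apply/eqP; rewrite eq_complex /=; apply/andP; split; apply/eqP.
    by rewrite mulrN opprK -!expr2 cos2Dsin2.
  by ring.
have z0 : zetaX R a != 0 by apply: contra_eq_neq h => ->; rewrite mul0r eq_sym oner_eq0.
by apply: (mulfI z0); rewrite h zetaX_mulN.
Qed.

Lemma zetaX_addN a : zetaX R a + zetaX R (- a) = (2 * rootcos n a : R)%:C.
Proof. by rewrite -conjc_zetaX addcJ zetaXE /= rmorphM rmorph_nat. Qed.

Lemma zetaX_neq1 a : a != 0 -> zetaX R a != 1.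
Proof.
move=> a0; apply: contraTneq (_ : rootcos n a < 1 :> R) => [h|].
  by move: h; rewrite zetaXE => -[-> _]; rewrite ltxx.
by apply: rootcos_lt1; rewrite ltn_Z lt0n andbT.
Qed.

(** Shifting [b] by 1 multiplies the sum by [zetaX R a], which differs from 1 unless [a] is 0. *)
Lemma sum_zetaX a : \sum_b zetaX R (a * b) = (a == 0)%:R * n%:R.
Proof.
have [->|a0] := eqVneq a 0.
  under eq_bigr do rewrite mul0r zetaX0.
  by rewrite sumr_const card_ord Zp_cast // mulr1n mul1r.
rewrite mulr0n mul0r; apply/eqP; rewrite -(mulrI_eq0 _ (_ : GRing.lreg (zetaX R a - 1))).
  rewrite mulrBl mul1r subr_eq0 mulr_sumr; apply/eqP; rewrite [RHS](reindex_inj (addrI 1)) /=.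
  by apply: eq_bigr => b _; rewrite mulrDr mulr1 zetaXD.
by apply: mulfI; rewrite subr_eq0 zetaX_neq1.
Qed.

Definition chi w p : C := zetaX R (w.1 * p.1 + w.2 * p.2).

Lemma chiDl w w' p : chi (w + w') p = chi w p * chi w' p.
Proof. by rewrite /chi /= -zetaXD; congr (zetaX R _); ring. Qed.

Lemma chiDr w p p' : chi w (p + p') = chi w p * chi w p'.
Proof. by rewrite /chi /= -zetaXD; congr (zetaX R _); ring. Qed.

Lemma chiC w p : chi w p = chi p w.
Proof. by rewrite /chi mulrC [w.2 * _]mulrC. Qed.

Lemma conjc_chi w p : conjc (chi w p) = chi (- w) p.
Proof. by rewrite /chi conjc_zetaX /=; congr (zetaX R _); ring. Qed.

Lemma sum_chi w : \sum_p chi w p = (w == 0)%:R * n%:R ^+ 2.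
Proof.
rewrite -(pair_bigA _ (fun a b => chi w (a, b))) /=.
under eq_bigr do under eq_bigr do rewrite /chi /= zetaXD.
under eq_bigr do rewrite -mulr_sumr.
rewrite -mulr_suml !sum_zetaX mulrACA -natrM mulnb -expr2.
by case: w => w1 w2.
Qed.

Lemma sum_chil p : \sum_w chi w p = (p == 0)%:R * n%:R ^+ 2.
Proof. by under eq_bigr do rewrite chiC; exact: sum_chi. Qed.

(** The whole normalisation sits here, so that pointwise products become plain convolutions. *)
Definition ift (P : Z2 -> C) p : C := n%:R ^- 2 * \sum_w chi w p * P w.

Let N0 : (n%:R ^+ 2 : C) != 0. Proof. by rewrite expf_neq0 // natrZ_neq0. Qed.

Lemma iftK P w : \sum_p ift P p * chi (- w) p = P w.
Proof.
under eq_bigr do rewrite /ift -mulrA mulr_suml.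
rewrite -mulr_sumr exchange_big /= (bigD1 w) //= [X in _ + X]big1 ?addr0.
  under eq_bigr do rewrite mulrAC -chiDl.
  by rewrite -mulr_suml subrr sum_chi eqxx mul1r mulrA mulVf // mul1r.
move=> v vw; under eq_bigr do rewrite mulrAC -chiDl.
by rewrite -mulr_suml sum_chi subr_eq0 (negbTE vw) !mul0r.
Qed.

Lemma ift_conv P Q p : \sum_q ift P q * ift Q (p - q) = ift (fun w => P w * Q w) p.
Proof.
under eq_bigr do rewrite {2}/ift mulrCA mulr_sumr.
rewrite -mulr_sumr exchange_big /=; congr (_ * _); apply: eq_bigr => w _.
rewrite -(iftK P w) mulr_suml mulr_sumr; apply: eq_bigr => q _.
rewrite chiDr; have -> : chi w (- q) = chi (- w) q by rewrite /chi /=; congr (zetaX R _); ring.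
by ring.
Qed.

Lemma ift_chi q p : ift (chi q) p = (p == - q)%:R.
Proof.
rewrite /ift; under eq_bigr do rewrite [chi q _]chiC -chiDr.
by rewrite sum_chil addr_eq0 mulrC mulfK.
Qed.

Lemma plancherel P :
  \sum_p ift P p * conjc (ift P p) = n%:R ^- 2 * \sum_w P w * conjc (P w).
Proof.
under eq_bigr do rewrite {2}/ift rmorphM rmorph_sum mulrCA mulr_sumr.
rewrite /= fmorphV rmorphXn rmorph_nat -mulr_sumr exchange_big /=.
congr (_ * _); apply: eq_bigr => w _.
rewrite -[X in _ = X * _](iftK P w) mulr_suml; apply: eq_bigr => q _.
by rewrite rmorphM /= conjc_chi mulrA.
Qed.

End Characters.

(** * Convolution *)

Section TensFun.
Local Open Scope complex_scope.
Context {R : realType} {n : nat}.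
Local Notation C := R[i].

Lemma tens_fun_is_scalar (nu mu : FY R n -> C) : scalar (tens_fun nu mu).
Proof.
move=> k s t; rewrite /tens_fun mulr_sumr -big_split; apply: eq_bigr => b _ /=.
rewrite mulr_sumr -big_split; apply: eq_bigr => c _ /=.
by rewrite !ffunE mulrDl -scalerAl.
Qed.
HB.instance Definition _ (nu mu : FY R n -> C) :=
  GRing.isLinear.Build C (FY2 R n) C *%R (tens_fun nu mu)
    (@tens_fun_is_scalar nu mu).

Lemma conv_is_scalar (nu mu : FY R n -> C) : scalar (Defs.conv nu mu).
Proof. by move=> k x y; rewrite /Defs.conv !linearP. Qed.
HB.instance Definition _ (nu mu : FY R n -> C) :=
  GRing.isLinear.Build C (FY R n) C *%R (Defs.conv nu mu)
    (@conv_is_scalar nu mu).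

(* On the matrix summand the functional is a Toeplitz (circulant) one, with
   value [g (i - j) / n] at the matrix unit [E_{i,j}]. *)
Definition spec_fun (P : 'Z_n * 'Z_n -> C) (g : 'Z_n -> C) (x : FY R n) : C :=
  \sum_p x.1 p * ift P p + \sum_i \sum_j x.2 i j * (n%:R^-1 * g (i - j)).

Lemma spec_fun_is_scalar P g : scalar (spec_fun P g).
Proof.
move=> k x y; rewrite /spec_fun mulrDr addrACA; congr (_ + _).
  rewrite mulr_sumr -big_split; apply: eq_bigr => p _ /=.
  by rewrite !ffunE mulrDl -scalerAl.
rewrite mulr_sumr -big_split; apply: eq_bigr => i _ /=.
rewrite mulr_sumr -big_split; apply: eq_bigr => j _ /=.
by rewrite !mxE mulrDl -mulrA.
Qed.
HB.instance Definition _ P g :=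
  GRing.isLinear.Build C (FY R n) C *%R (spec_fun P g) (@spec_fun_is_scalar P g).

Lemma spec_fun_e P g i j : spec_fun P g (e_ R i j) = ift P (i, j).
Proof.
rewrite /spec_fun [X in _ + X]big1 ?addr0; last first.
  by move=> a _; rewrite big1 // => b _; rewrite mxE mul0r.
rewrite (bigD1 (i, j)) //= ffunE eqxx mul1r big1 ?addr0 // => p pij.
by rewrite ffunE (negbTE pij) mul0r.
Qed.

Lemma spec_fun_E P g i j : spec_fun P g (E_ R i j) = n%:R^-1 * g (i - j).
Proof.
rewrite /spec_fun big1 ?add0r; last by move=> p _; rewrite ffunE mul0r.
rewrite (bigD1 i) //= [X in _ + X]big1 ?addr0; last first.
  by move=> a ai; rewrite big1 // => b _; rewrite mxE (negbTE ai) mul0r.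
rewrite (bigD1 j) //= mxE !eqxx mul1r big1 ?addr0 // => b bj.
by rewrite mxE (negbTE bj) andbF mul0r.
Qed.

End TensFun.

Section Convolution.
Local Open Scope complex_scope.
Context {R : realType} {n : nat} (n1 : (1 < n)%N).
Local Notation C := R[i].
Local Notation Z := 'Z_n.
Implicit Types (P Q : 'Z_n * 'Z_n -> C) (g h : 'Z_n -> C).

(** The phases in [Delta_E] involve only the first index of [e_], so a matrix unit sees [P] only on
    the line of vanishing second frequency. *)
Lemma sum_ift_zetaX P d :
  \sum_a \sum_b ift P (a, b) * zetaX R (- (a * d)) = P (d, 0).
Proof.
rewrite -[RHS](iftK n1) -(pair_bigA _ (fun a b => ift P (a, b) * chi (- (d, 0)) (a, b))) /=.
apply: eq_bigr => a _; apply: eq_bigr => b _; congr (_ * zetaX R _) => /=.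
by ring.
Qed.

Lemma sum_diff (h : Z -> C) : \sum_i \sum_j h (i - j) = n%:R * \sum_d h d.
Proof.
transitivity (\sum_(i : Z) \sum_d h d).
  apply: eq_bigr => i _; rewrite [RHS](reindex_inj (subrI i)) /=.
  by apply: eq_bigr.
rewrite sumr_const card_ord mulr_natl; congr (_ *+ _); exact: Zp_cast.
Qed.

(** Data supported on that line transform to functions of [p.1] alone; the product of two matrix
    parts contributes such a function. *)
Lemma ift_diag g p :
  ift (fun w => (w.2 == 0)%:R * g w.1) p =
  n%:R ^- 2 * \sum_d zetaX R (d * p.1) * g d :> C.
Proof.
rewrite /ift -(pair_bigA _ (fun a b => chi (a, b) p * ((b == 0)%:R * g a))) /=.
congr (_ * _); apply: eq_bigr => a _.
rewrite (bigD1 0) //= mul1r big1 ?addr0 => [|b /negbTE ->].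
  by rewrite /chi /= mul0r addr0.
by rewrite mul0r mulr0.
Qed.

(** In [Delta_e] the shift by [j] cancels in the row-column differences, so two matrix parts
    multiply to [g1 * g2] on the line; in [Delta_E] the scalar part of one factor multiplies the
    matrix part of the other. *)
Lemma conv_spec_fun P1 P2 g1 g2 :
  Defs.conv (@spec_fun R n P1 g1) (spec_fun P2 g2) =
  spec_fun (fun w => P1 w * P2 w + (w.2 == 0)%:R * (g1 w.1 * g2 w.1))
           (fun d => P1 (d, 0) * g2 d + g1 d * P2 (d, 0)).
Proof.
apply: funext => x; rewrite [x]bvec_sum !linear_sum; apply: eq_bigr => b _.
rewrite !linearZ /=; congr (_ * _).
rewrite /Defs.conv Delta_bvec; case: b => -[i j] /=.
  rewrite spec_fun_e [RHS]/ift.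
  under [in RHS]eq_bigr do rewrite mulrDr.
  rewrite big_split /= mulrDr -/(ift _ _) -/(ift _ _) (ift_diag (fun d => g1 d * g2 d)).
  rewrite /Delta_e linearD linearZ /= !linear_sum; congr (_ + _).
    rewrite -(ift_conv n1) -(pair_bigA _ (fun a b => ift P1 (a, b) * ift P2 ((i, j) - (a, b)))) /=.
    apply: eq_bigr => l _; rewrite linear_sum; apply: eq_bigr => m _.
    by rewrite /= tens_funE /= !spec_fun_e.
  pose F (d : Z) : C := n%:R ^- 2 * (zetaX R (d * i) * (g1 d * g2 d)).
  transitivity (n%:R^-1 * \sum_l \sum_m F (l - m)).
    congr (_ * _); apply: eq_bigr => l _; rewrite linear_sum; apply: eq_bigr => m _.
    rewrite linearZ /= tens_funE /= !spec_fun_E opprD addrACA subrr addr0.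
    by rewrite /F [i * _]mulrC expr2 invfM; ring.
  rewrite sum_diff mulrA mulVf ?natrZ_neq0 // mul1r.
  by rewrite /F -mulr_sumr.
rewrite spec_fun_E /Delta_E linearD /= mulrDr !linear_sum; congr (_ + _).
  (* The first sum of [Delta_E] carries [e_ (- l) (- m)], hence the reindexing by negation in both
     variables. *)
  rewrite -sum_ift_zetaX (reindex_inj oppr_inj) /= mulr_suml mulr_sumr.
  apply: eq_bigr => l _; rewrite linear_sum mulr_suml mulr_sumr (reindex_inj oppr_inj) /=.
  apply: eq_bigr => m _; rewrite /= tens_funE linearZ /= ?linearZ /= spec_fun_e spec_fun_E !opprK.
  rewrite opprD addrACA subrr addr0 mulNr.
  by ring.
rewrite -sum_ift_zetaX mulr_sumr mulr_sumr.
apply: eq_bigr => l _; rewrite linear_sum !mulr_sumr.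
apply: eq_bigr => m _; rewrite /= tens_funE linearZ /= ?linearZ /= spec_fun_e spec_fun_E.
rewrite opprD addrACA subrr addr0 -mulrN opprB.
by ring.
Qed.

End Convolution.

(** * Fourier data of the walk and of the Haar state *)

Section Walk.
Local Open Scope complex_scope.
Context {R : realType} {n : nat} (n1 : (1 < n)%N).
Local Notation C := R[i].
Local Notation Z := 'Z_n.
Local Notation Z2 := ('Z_n * 'Z_n)%type.

Lemma rootcos0 : rootcos n 0 = 1 :> R.
Proof. by rewrite /rootcos mulr0n cos0. Qed.

(** The eigenvalue of P - g on the line; it lies between -1/2 and 0, so its powers are
    negligible. *)
Definition eigB (u : nat) : R := (rootcos n u - 1) / 4.

(* The Fourier data of the k-th convolution power of the walk. *)
Definition walk_e (k : nat) (w : Z2) : R :=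
  if w.2 == 0 then (eigA n w.1 ^+ k + eigB w.1 ^+ k) / 2
  else ((rootcos n w.1 + rootcos n w.2) / 4) ^+ k.

Definition walk_E (k : nat) (d : Z) : R := (eigA n d ^+ k - eigB d ^+ k) / 2.

Lemma walk_e1 w : (walk_e 1 w)%:C =
  8%:R^-1 * (chi (0, 1) w + chi (1, 0) w + chi (- 1, 0) w + chi (0, - 1) w).
Proof.
rewrite /chi /= !mul0r !mul1r !mulN1r !add0r !addr0.
have -> : walk_e 1 w = 8^-1 * (2 * rootcos n w.1 + 2 * rootcos n w.2).
  rewrite /walk_e !expr1; case: eqP => [->|_]; last by field.
  by rewrite rootcos0 /eigA /eigB; field.
rewrite rmorphM fmorphV rmorph_nat rmorphD /= -!(zetaX_addN n1).
by congr (_ * _); ring.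
Qed.

Lemma walk_E1 d : (walk_E 1 d)%:C = 2^-1.
Proof.
have -> : walk_E 1 d = 2^-1 by rewrite /walk_E /eigA /eigB; field.
by rewrite fmorphV rmorph_nat.
Qed.

Lemma sum_mulr_delta (f : Z2 -> C) q : \sum_p f p * (p == q)%:R = f q.
Proof.
rewrite (bigD1 q) //= eqxx mulr1 big1 ?addr0 // => p /negbTE ->.
by rewrite mulr0.
Qed.

Lemma nu_walkE : @nu_walk R n =
  spec_fun (fun w => (walk_e 1 w)%:C) (fun d => (walk_E 1 d)%:C).
Proof.
apply: funext => x; rewrite /nu_walk /spec_fun; congr (_ + _).
  have e p : ift (fun w => (walk_e 1 w)%:C) p = 8%:R^-1 *
      ((p == (0, -1))%:R + (p == (-1, 0))%:R + (p == (1, 0))%:R + (p == (0, 1))%:R).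
    rewrite /ift; under eq_bigr do rewrite walk_e1 mulrCA.
    rewrite -mulr_sumr mulrCA; congr (_ * _).
    under eq_bigr do rewrite !mulrDr.
    rewrite !big_split /= !mulrDr.
    have h q : n%:R ^- 2 * \sum_w chi w p * chi q w = (p == - q)%:R :> C by exact: ift_chi.
    have o (a b : Z) : - ((a, b) : Z2) = (- a, - b) by [].
    by rewrite !h !o !oppr0 !opprK.
  under eq_bigr do rewrite e mulrCA.
  rewrite -mulr_sumr; congr (_ * _).
  under eq_bigr do rewrite !mulrDr.
  rewrite !big_split /= !sum_mulr_delta.
  by rewrite /dual_e; ring.
rewrite mulr_sumr; apply: eq_bigr => i _; rewrite mulr_sumr; apply: eq_bigr => j _.
by rewrite walk_E1 /dual_E invfM; ring.
Qed.

Lemma eq_spec_fun (P Q : Z2 -> C) (g h : Z -> C) : P =1 Q -> g =1 h ->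
  @spec_fun R n P g = spec_fun Q h.
Proof. by move=> /funext -> /funext ->. Qed.

Lemma convpow_nu_walk k : (0 < k)%N -> convpow (@nu_walk R n) k =
  spec_fun (fun w => (walk_e k w)%:C) (fun d => (walk_E k d)%:C).
Proof.
case: k => // k _; rewrite /convpow /=; elim: k => [|k IH]; first exact: nu_walkE.
rewrite iterS IH nu_walkE (conv_spec_fun n1); apply: eq_spec_fun => [w|d] /=.
  rewrite -!rmorphM /=; have -> : ((w.2 == 0)%:R : C) = ((w.2 == 0)%:R : R)%:C.
    by rewrite rmorph_nat.
  rewrite -rmorphM -rmorphD /=; congr (_ %:C).
  (* On the line P = (A + B) / 2 and g = (A - B) / 2, so P P' + g g' = (A A' + B B') / 2; likewise
     the mixed terms below give (A A' - B B') / 2. *)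
  rewrite /walk_e /walk_E; case: eqP => _; last by rewrite mul0r addr0 expr1 -exprS.
  rewrite mul1r !expr1 [in RHS]exprS [eigB _ ^+ k.+2]exprS.
  by rewrite /eigA /eigB; field.
rewrite -!rmorphM -rmorphD /=; congr (_ %:C).
rewrite /walk_e /walk_E /= !expr1 [in RHS]exprS [eigB _ ^+ k.+2]exprS.
by rewrite /eigA /eigB; field.
Qed.

Lemma haarE : @haar R n =
  spec_fun (fun w => ((w == 0)%:R / 2 : R)%:C) (fun d => ((d == 0)%:R / 2 : R)%:C).
Proof.
apply: funext => x; rewrite /haar /spec_fun mulrDr; congr (_ + _).
  rewrite pair_bigA mulr_sumr; apply: eq_bigr => -[i j] _ /=.
  rewrite mulrC /ift (bigD1 (0 : Z2)) //= [X in _ + X]big1 ?addr0; last first.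
    by move=> w /negbTE ->; rewrite mul0r rmorph0 mulr0.
  rewrite /chi /= !mul0r addr0 zetaX0 mul1r.
  by rewrite mul1r fmorphV rmorph_nat invfM [_^-1 * _^-1]mulrC.
rewrite /mxtrace !mulr_sumr; apply: eq_bigr => i _.
rewrite (bigD1 i) //= [X in _ + X]big1 ?addr0; last first.
  by move=> j ji; rewrite subr_eq0 eq_sym (negbTE ji) mul0r rmorph0 !mulr0.
rewrite subrr eqxx mul1r fmorphV rmorph_nat.
have := natrZ_neq0 n1 (R := R); move: (n%:R : C) => N N0.
by field.
Qed.

End Walk.

(** * Total variation *)

Section Modulus.
Local Open Scope complex_scope.
Context {R : realType}.
Local Notation C := R[i].
Local Notation normc := (@ComplexField.Normc.normc R).

Lemma sqr_normcE (z : C) : (normc z ^+ 2)%:C = z * conjc z.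
Proof. by rewrite -sqr_normc rmorphXn. Qed.

Lemma Re_le_normc (z : C) : complex.Re z <= normc z.
Proof. by apply: le_trans (ler_norm _) _; rewrite -lecR; exact: normc_ge_Re. Qed.

Lemma le_normc_sum (I : finType) (f : I -> C) :
  normc (\sum_i f i) <= \sum_i normc (f i).
Proof.
elim/big_ind2: _ => [|x1 x2 y1 y2 h1 h2|//]; first by rewrite ComplexField.Normc.normc0.
by apply: le_trans (complex.le_normcD _ _) (lerD h1 h2).
Qed.

Lemma Re_sum (I : finType) (f : I -> C) : complex.Re (\sum_i f i) = \sum_i complex.Re (f i).
Proof. by apply: (big_morph (@complex.Re R)) => // -[a b] [c d]. Qed.

(** Cauchy-Schwarz in its weighted arithmetic-geometric form, free of square roots; the weight [t]
    is tuned at the point of use. *)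
Lemma normc_sum_amgm (I : finType) (a b : I -> C) (t : R) : 0 < t ->
  normc (\sum_i a i * b i) <=
    (t^-1 * \sum_i normc (a i) ^+ 2 + t * \sum_i normc (b i) ^+ 2) / 2.
Proof.
move=> t0; apply: le_trans (le_normc_sum _) _.
rewrite !mulr_sumr -big_split mulr_suml; apply: ler_sum => i _ /=.
rewrite ComplexField.Normc.normcM; set x := normc (a i); set y := normc (b i).
have : 0 <= t^-1 * (x - t * y) ^+ 2 by rewrite mulr_ge0 ?sqr_ge0 // invr_ge0 ltW.
rewrite (_ : t^-1 * _ = t^-1 * x ^+ 2 + t * y ^+ 2 - 2 * (x * y)); first lra.
by field; rewrite gt_eqF.
Qed.

End Modulus.

Section TotalVariation.
Local Open Scope complex_scope.
Context {R : realType} {n : nat} (n1 : (1 < n)%N).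
Local Notation C := R[i].
Local Notation Z := 'Z_n.
Local Notation Z2 := ('Z_n * 'Z_n)%type.
Local Notation normc := (@ComplexField.Normc.normc R).
Implicit Types (r : Z2 -> R) (s : Z -> R).

Definition real_spec r s : FY R n -> C :=
  spec_fun (fun w => (r w)%:C) (fun d => (s d)%:C).

Lemma real_spec1 r s : real_spec r s 1 = (r 0 + s 0)%:C.
Proof.
rewrite rmorphD /=; congr (_ + _).
  rewrite -(iftK n1 (fun w => (r w)%:C)); apply: eq_bigr => q _.
  by rewrite ffunE mul1r /chi /= !oppr0 !mul0r addr0 zetaX0 mulr1.
transitivity (\sum_(i : Z) n%:R^-1 * (s 0)%:C).
  apply: eq_bigr => i _; rewrite (bigD1 i) //= big1 ?addr0.
    by rewrite mxE eqxx mul1r subrr.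
  by move=> j ji; rewrite mxE eq_sym (negbTE ji) mul0r.
rewrite sumr_const card_ord; transitivity ((n%:R^-1 * (s 0)%:C) *+ n).
  by congr (_ *+ _); exact: Zp_cast.
by rewrite -[LHS]mulr_natl mulrA mulfV ?mul1r // natrZ_neq0.
Qed.

Lemma plancherel_e r :
  \sum_p normc (ift (fun w => (r w)%:C) p) ^+ 2 = n%:R ^- 2 * \sum_w r w ^+ 2.
Proof.
apply: complexI; rewrite /= rmorph_sum rmorphM fmorphV rmorphXn rmorph_nat /=.
under eq_bigr do rewrite sqr_normcE.
rewrite (plancherel n1) rmorph_sum; congr (_ * _); apply: eq_bigr => w _.
by rewrite conjc_real -rmorphM.
Qed.

Lemma plancherel_E s :
  \sum_(q : Z2) normc (n%:R^-1 * (s (q.1 - q.2))%:C) ^+ 2 = n%:R^-1 * \sum_d s d ^+ 2.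
Proof.
rewrite -(pair_bigA _ (fun a b => normc (n%:R^-1 * (s (a - b))%:C) ^+ 2)) /=.
pose F (d : Z) : C := n%:R ^- 2 * (s d ^+ 2)%:C.
apply: complexI; rewrite /= rmorph_sum.
transitivity (\sum_i \sum_j F (i - j)).
  apply: eq_bigr => i _; rewrite rmorph_sum; apply: eq_bigr => j _.
  rewrite /= sqr_normcE rmorphM fmorphV rmorph_nat.
  rewrite -[complex_conjc__canonical__GRing_RMorphism R _]/(conjc _) conjc_real.
  rewrite /F rmorphXn expr2 invfM.
  by ring.
rewrite (sum_diff n1) /F -mulr_sumr mulrA rmorphM fmorphV rmorph_nat rmorph_sum.
by congr (_ * _); rewrite expr2 invfM mulrA mulfV ?mul1r // natrZ_neq0.
Qed.

Lemma reflection_sqr (A : pzRingType) (p : A) :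
  p = p * p -> (p + p - 1) * (p + p - 1) = 1.
Proof.
move=> pp; have h : (p + p - 1) * p = p by rewrite mulrBl mulrDl -pp mul1r addrK.
by rewrite mulrBr mulr1 mulrDr h opprB addrCA subrr addr0.
Qed.

Lemma reflection_normc_e (p : FY R n) q : projection p ->
  normc ((p + p - 1).1 q) ^+ 2 = 1.
Proof.
move=> [ps pp]; apply: complexI; rewrite sqr_normcE.
have h : conjc ((p + p - 1).1 q) = (p + p - 1).1 q.
  have e : conjc (p.1 q) = p.1 q by rewrite [in RHS]ps ffunE.
  rewrite !ffunE !rmorphD rmorphN1.
  by rewrite -[complex_conjc__canonical__GRing_RMorphism R _]/(conjc _) e.
by rewrite h; have := congr1 (fun y : FY R n => y.1 q) (reflection_sqr pp); rewrite /= !ffunE.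
Qed.

(** The matrix part of the reflection is Hermitian with square 1, so every row has norm 1. *)
Lemma reflection_normc_E (p : FY R n) : projection p ->
  \sum_(q : Z2) normc ((p + p - 1).2 q.1 q.2) ^+ 2 = n%:R.
Proof.
move=> [ps pp]; set x := p + p - 1.
have h i j : conjc (x.2 i j) = x.2 j i.
  have e : conjc (p.2 i j) = p.2 j i by rewrite [in RHS]ps !mxE.
  rewrite /x !mxE !rmorphD rmorphN.
  rewrite -[complex_conjc__canonical__GRing_RMorphism R (p.2 i j)]/(conjc _) e.
  by rewrite rmorph_nat eq_sym.
rewrite -(pair_bigA _ (fun i j => normc (x.2 i j) ^+ 2)) /=.
apply: complexI; rewrite /= rmorph_sum rmorph_nat.
transitivity (\sum_(i : Z) (1 : C)).
  apply: eq_bigr => i _; rewrite rmorph_sum /=.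
  under eq_bigr do rewrite sqr_normcE h.
  have := congr1 (fun y : FY R n => y.2 i i) (reflection_sqr pp).
  by rewrite /= !mxE eqxx.
rewrite sumr_const card_ord; congr (_ *+ _); exact: Zp_cast.
Qed.

Lemma real_spec_proj_le r s (T : R) (p : FY R n) : 0 < T -> r 0 + s 0 = 0 ->
  \sum_w r w ^+ 2 + \sum_d s d ^+ 2 <= 2 * T ^+ 2 -> projection p ->
  normc (real_spec r s p) <= T.
Proof.
move=> T0 rs0 rsT hp; set x := p + p - 1.
have nR : (0 : R) < n%:R by rewrite ltr0n ltnW.
have e : real_spec r s x = (2 : R)%:C * real_spec r s p.
  rewrite /x /real_spec linearB linearD /= -/(real_spec r s 1) real_spec1 rs0.
  by rewrite rmorph0 subr0 rmorph_nat; ring.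
have nx : normc (real_spec r s x) = 2 * normc (real_spec r s p).
  by rewrite e ComplexField.Normc.normcM /= expr0n /= addr0 sqrtr_sqr ger0_norm.
suff : normc (real_spec r s x) <= 2 * T by rewrite nx; lra.
rewrite /real_spec /spec_fun (pair_bigA _ (fun i j => x.2 i j * _)) /=.
apply: le_trans (complex.le_normcD _ _) _.
have n2 : n%:R != 0 :> R by rewrite gt_eqF.
have T2 : T != 0 by rewrite gt_eqF.
(* The weights n^2 / T and n / T cancel the Plancherel factors; the two bounds become (T + X / T) /
   2 and (T + Y / T) / 2, where X and Y are the energies of [r] and [s]. *)
have h1 := @normc_sum_amgm R _ (fun q : Z2 => x.1 q)
  (fun q => ift (fun w => (r w)%:C) q) (n%:R ^+ 2 / T)
  (divr_gt0 (exprn_gt0 2 nR) T0).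
have h2 := @normc_sum_amgm R _ (fun q : Z2 => x.2 q.1 q.2)
  (fun q => n%:R^-1 * (s (q.1 - q.2))%:C) (n%:R / T) (divr_gt0 nR T0).
apply: le_trans (lerD h1 h2) _.
have e1 : \sum_(q : Z2) normc (x.1 q) ^+ 2 = n%:R ^+ 2.
  transitivity (\sum_(q : Z2) (1 : R)).
    by apply: eq_bigr => q _; exact: reflection_normc_e.
  rewrite sumr_const card_prod card_ord -natrX -mulnn.
  by congr (_ *+ (_ * _)); exact: Zp_cast.
rewrite plancherel_e plancherel_E (reflection_normc_E hp) e1.
move: rsT; set X := \sum_w _; set Y := \sum_d _ => rsT.
rewrite (_ : _ + _ = T + (X + Y) / (2 * T)); last by field; rewrite T2 n2.
have : (X + Y) / (2 * T) <= T by rewrite ler_pdivrMr; [nra | lra].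
lra.
Qed.

(** * A projection that witnesses the lower bound *)

Section Witness.
Variables (r : Z2 -> R) (s : Z -> R).

Let lambda (u : Z) : R := r (u, 0) + s u.

(** The inverse Fourier transform of [lambda] on Z_n, which is the value of the functional at the
    spectral projection of the single index [c]. *)
Let mu (c : Z) : C := n%:R^-1 * \sum_u zetaX R (u * c) * (lambda u)%:C.

(* The spectral projection, for the eigenvalues indexed by [S], of the unitary
   that is [zeta ^ i] on [e_(i,j)] and a cyclic shift on M_n(C). *)
Definition spectral_proj (S : {set Z}) : FY R n :=
  ([ffun q : Z2 => (q.1 \in S)%:R],
   \matrix_(a, b) (n%:R^-1 * \sum_(c in S) zetaX R (c * (a - b)))).

Lemma spectral_proj_projection S : projection (spectral_proj S).
Proof.
have N0 := natrZ_neq0 n1 (R := R).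
split; congr (_, _).
- by apply/ffunP => q; rewrite !ffunE rmorph_nat.
- apply/matrixP => a b; rewrite !mxE rmorphM fmorphV rmorph_nat rmorph_sum /=.
  congr (_ * _); apply: eq_bigr => c _.
  by rewrite conjc_zetaX // -mulrN opprB.
- by apply/ffunP => q; rewrite !ffunE -natrM mulnb andbb.
apply/matrixP => a b; rewrite !mxE.
(* The square of the matrix is a double sum over [S]; orthogonality of characters leaves the
   diagonal. *)
transitivity (n%:R^-1 * (n%:R^-1 * \sum_(c in S) \sum_(c' in S) zetaX R (c * a - c' * b) *
   \sum_d zetaX R ((c' - c) * d))).
  congr (_ * _); rewrite mulr_sumr; apply: eq_bigr => c cS.
  rewrite (bigD1 c) //= [X in _ = _ * (_ + X)]big1 ?addr0.
    by rewrite sum_zetaX // subrr eqxx mul1r mulrCA mulVf // mulr1 mulrBr.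
  by move=> c' /andP[_ c'c]; rewrite sum_zetaX // subr_eq0 (negbTE c'c) mul0r mulr0.
rewrite mulrA -invfM -/(_ ^+ 2).
under eq_bigr do under eq_bigr do rewrite mulr_sumr.
under eq_bigr do rewrite exchange_big.
rewrite exchange_big /= mulr_sumr; apply: eq_bigr => d _; rewrite !mxE mulrACA -invfM.
congr (_ * _); rewrite mulr_suml; apply: eq_bigr => c _.
rewrite mulr_sumr; apply: eq_bigr => c' _.
by rewrite -!zetaXD //; congr (zetaX R _); ring.
Qed.

Lemma real_spec_spectral_proj S :
  real_spec r s (spectral_proj S) = \sum_(c in S) mu c.
Proof.
have N0 := natrZ_neq0 n1 (R := R).
under [RHS]eq_bigr do rewrite /mu; rewrite -mulr_sumr.
under [in RHS]eq_bigr do under eq_bigr do rewrite rmorphD /= mulrDr.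
under [in RHS]eq_bigr do rewrite big_split.
rewrite big_split mulrDr /=; congr (_ + _).
  transitivity (\sum_i \sum_j (i \in S)%:R * ift (fun w => (r w)%:C) (i, j)).
    by rewrite pair_bigA; apply: eq_bigr => -[i j] _; rewrite ffunE.
  rewrite [in RHS]big_mkcond mulr_sumr; apply: eq_bigr => i _ /=.
  case: ifP => _; last by rewrite mulr0 big1 // => j _; rewrite mul0r.
  under eq_bigr do rewrite mul1r.
  rewrite /ift -mulr_sumr exchange_big /=.
  have -> : \sum_w \sum_j chi w (i, j) * (r w)%:C =
      \sum_a \sum_b \sum_j chi (a, b) (i, j) * (r (a, b))%:C.
    by rewrite [RHS]pair_bigA; apply: eq_bigr => -[a b] _.
  rewrite expr2 invfM -mulrA; congr (_ * _); rewrite mulr_sumr; apply: eq_bigr => u _.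
  under eq_bigr do rewrite -mulr_suml.
  under eq_bigr do under eq_bigr do rewrite /chi /= zetaXD //.
  under eq_bigr do rewrite -mulr_sumr sum_zetaX //.
  (* The projection ignores the second coordinate, and summing over it keeps only the frequency
     0. *)
  rewrite (bigD1 0) //= [X in _ + X]big1 ?addr0.
    by rewrite mul1r mulrAC mulrC mulfK.
  by move=> v /negbTE ->; rewrite mul0r mulr0 mul0r.
pose F (d : Z) : C := n%:R^-1 * (n%:R^-1 * \sum_(c in S) zetaX R (d * c) * (s d)%:C).
transitivity (\sum_i \sum_j F (i - j)).
  apply: eq_bigr => i _; apply: eq_bigr => j _; rewrite mxE /F -mulr_suml.
  under eq_bigr do rewrite mulrC.
  by ring.
rewrite (sum_diff n1) /F -mulr_sumr mulrA mulfV // mul1r -mulr_sumr; congr (_ * _).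
exact: exchange_big.
Qed.

Lemma sum_mu v : \sum_c mu c * zetaX R (- (v * c)) = (lambda v)%:C.
Proof.
have N0 := natrZ_neq0 n1 (R := R).
rewrite /mu; under eq_bigr do rewrite -mulrA mulr_suml.
rewrite -mulr_sumr exchange_big /= (bigD1 v) //= [X in _ + X]big1 ?addr0.
  under eq_bigr do rewrite mulrAC -zetaXD // -mulrBl.
  by rewrite -mulr_suml sum_zetaX // subrr eqxx mul1r mulrA mulVf // mul1r.
move=> u uv; under eq_bigr do rewrite mulrAC -zetaXD // -mulrBl.
by rewrite -mulr_suml sum_zetaX // subr_eq0 (negbTE uv) !mul0r.
Qed.

(* The numbers [complex.Re (mu c)] form a signed measure of total mass [0] on
   Z_n; the witness is the spectral projection of its positive part, tested
   against the function [cos (2 * pi * c / n)], bounded by [1]. *)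
Lemma real_spec_proj_ge : r 0 + s 0 = 0 ->
  exists2 p : FY R n, projection p &
    (lambda 1 + lambda (-1)) / 4 <= normc (real_spec r s p).
Proof.
move=> rs0; pose m c := complex.Re (mu c).
pose S := [set c : Z | 0 < m c]%SET.
exists (spectral_proj S); first exact: spectral_proj_projection.
apply: le_trans (Re_le_normc _); rewrite real_spec_spectral_proj.
rewrite big_mkcond Re_sum.
have m0 : \sum_c m c = 0.
  rewrite -Re_sum; have := sum_mu 0; under eq_bigr do rewrite mul0r oppr0 zetaX0 mulr1.
  by move=> ->; rewrite /lambda /= -[(0, 0)]/(0 : Z2) rs0.
have m1 : \sum_c m c * (2 * rootcos n c) = lambda 1 + lambda (-1).
  have /(congr1 (@complex.Re R)) : \sum_c mu c * (2 * rootcos n c : R)%:C =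
      (lambda 1 + lambda (-1))%:C.
    rewrite rmorphD /= -!sum_mu -big_split; apply: eq_bigr => c _.
    by rewrite -zetaX_addN // mulrDr mul1r mulN1r opprK addrC.
  rewrite Re_sum /= => <-; apply: eq_bigr => c _; rewrite /m.
  by case: (mu c) => a b /=; rewrite mulr0 subr0.
(* Termwise, 2 m cos <= 2 |m| = 4 m^+ - 2 m, where m^+ is the positive part; the last term sums to 0
   by [m0]. *)
suff : \sum_c m c * (2 * rootcos n c) <=
    \sum_c (4 * complex.Re (if c \in S then mu c else 0) - 2 * m c).
  by rewrite m1 sumrB -!mulr_sumr m0; lra.
apply: ler_sum => c _; rewrite inE -/(m c).
have c1 := cos_le1 ((2 * pi / n%:R) *+ c : R).
have c2 := cos_geN1 ((2 * pi / n%:R) *+ c : R).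
rewrite /rootcos; case: ltP => h; rewrite /= -/(m c); nra.
Qed.

End Witness.

End TotalVariation.

(** * Distance from the walk to the Haar state *)

Section Distance.
Local Open Scope complex_scope.
Context {R : realType} {n : nat} (n1 : (1 < n)%N).
Local Notation C := R[i].
Local Notation Z := 'Z_n.
Local Notation Z2 := ('Z_n * 'Z_n)%type.
Local Notation normc := (@ComplexField.Normc.normc R).

Definition diff_e (k : nat) (w : Z2) : R := walk_e k w - (w == 0)%:R / 2.

Definition diff_E (k : nat) (d : Z) : R := walk_E k d - (d == 0)%:R / 2.

Lemma convpow_sub_haar k (x : FY R n) : (0 < k)%N ->
  convpow (@nu_walk R n) k x - haar x = real_spec (diff_e k) (diff_E k) x.
Proof.
move=> k0; rewrite (convpow_nu_walk n1 k0) (haarE n1) /real_spec /spec_fun opprD addrACA.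
congr (_ + _); rewrite -sumrB; apply: eq_bigr => i _.
  rewrite -mulrBr; congr (_ * _); rewrite /ift -mulrBr -sumrB; congr (_ * _).
  by apply: eq_bigr => w _; rewrite -mulrBr rmorphB.
rewrite -sumrB; apply: eq_bigr => j _.
by rewrite -mulrBr -mulrBr -rmorphB.
Qed.

Lemma pair_eq0 (u v : Z) : ((u, v) == 0 :> Z2) = (u == 0) && (v == 0).
Proof. exact: xpair_eqE. Qed.

(** At u = 0 the eigenvalues are A = 1 and B = 0, so for positive [k] the value 1/2 of the Haar
    state cancels exactly. *)
Lemma diff_eE k (u : Z) : (0 < k)%N ->
  diff_e k (u, 0) = (u != 0)%:R * ((eigA n u ^+ k + @eigB R n u ^+ k) / 2).
Proof.
move=> k0; rewrite /diff_e /walk_e /= pair_eq0 eqxx andbT.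
have [->|_] := eqVneq u 0; last by rewrite /=; ring.
rewrite /eigA /eigB rootcos0 subrr mul0r expr0n gtn_eqF //.
rewrite (_ : (3 + 1) / 4 = 1) ?expr1n /=; first by field.
by field.
Qed.

Lemma diff_EE k (u : Z) : (0 < k)%N ->
  diff_E k u = (u != 0)%:R * ((eigA n u ^+ k - @eigB R n u ^+ k) / 2).
Proof.
move=> k0; rewrite /diff_E /walk_E.
have [->|_] := eqVneq u 0; last by rewrite /=; ring.
rewrite /eigA /eigB rootcos0 subrr mul0r expr0n gtn_eqF //.
rewrite (_ : (3 + 1) / 4 = 1) ?expr1n /=; first by field.
by field.
Qed.

Lemma diff_sum0 k : (0 < k)%N -> diff_e k 0 + diff_E k 0 = 0.
Proof.
by move=> k0; rewrite -[diff_e k 0]/(diff_e k (0, 0)) diff_eE // diff_EE // eqxx !mul0r addr0.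
Qed.

Lemma sum_Z_nat (F : nat -> R) : \sum_(u : Z) F u = \sum_(0 <= u < n) F u.
Proof. by rewrite -[in RHS](Zp_cast n1) big_mkord. Qed.

Lemma sqr_le_quarter (x : R) k : `|x| <= 1 / 2 -> (x ^+ k) ^+ 2 <= (1 / 4) ^+ k.
Proof.
move=> xh; rewrite -exprM mulnC exprM lerXn2r ?nnegrE ?sqr_ge0 //.
rewrite -real_normK ?num_real //; have := normr_ge0 x; nra.
Qed.

(** On the line the squares of (A^k + B^k) / 2 and (A^k - B^k) / 2 add up to (A^(2k) + B^(2k)) / 2.
    The [eigB] terms and those off the line have base at most 1/2 in modulus, and n (1/2 + n) <= 3/2
    n^2. *)
Lemma diff_energy_le k : (0 < k)%N ->
  \sum_w diff_e k w ^+ 2 + \sum_d diff_E k d ^+ 2 <=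
  1 / 2 * \sum_(1 <= u < n) eigA n u ^+ (2 * k) + 3 / 2 * n%:R ^+ 2 * (1 / 4) ^+ k.
Proof.
move=> k0.
have q0 : 0 <= (1 / 4 : R) ^+ k by rewrite exprn_ge0.
have rc (u : nat) : -1 <= (rootcos n u : R) <= 1 by rewrite /rootcos cos_geN1 cos_le1.
have hz (u : Z) : \sum_v diff_e k (u, v) ^+ 2 + diff_E k u ^+ 2 <=
   (if u != 0 then eigA n u ^+ (2 * k) / 2 else 0) + (1 / 2 + n%:R) * (1 / 4) ^+ k.
  rewrite (bigD1 0) //= diff_eE // diff_EE //.
  have h1 : \sum_(v | v != 0) diff_e k (u, v) ^+ 2 <= n%:R * (1 / 4) ^+ k.
    apply: le_trans (_ : \sum_(v : Z) (1 / 4) ^+ k <= _).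
      rewrite [leRHS](bigD1 0) //= ler_wpDl //; apply: ler_sum => v v0.
      rewrite /diff_e /walk_e /= pair_eq0 (negbTE v0) andbF mul0r subr0.
      apply: sqr_le_quarter; rewrite ler_norml.
      by have /andP[? ?] := rc u; have /andP[? ?] := rc v; apply/andP; split; lra.
    by rewrite sumr_const card_ord -[leLHS]mulr_natl (Zp_cast n1).
  have hB : (@eigB R n u ^+ k) ^+ 2 <= (1 / 4) ^+ k :> R.
    apply: sqr_le_quarter; rewrite ler_norml /eigB.
    by have /andP[? ?] := rc u; apply/andP; split; lra.
  have hA : eigA n u ^+ (2 * k) = (eigA n u ^+ k) ^+ 2 :> R by rewrite -exprM mulnC.
  have [_|_] := eqVneq u 0; rewrite /= ?hA; move: h1 hB; set X := \sum_(v | _) _.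
    by rewrite !mul0r expr0n /=; lra.
  rewrite !mul1r => h1 hB.
  by set a := eigA n u ^+ k; move: hB; set b := @eigB R n u ^+ k => hB; lra.
rewrite -(pair_bigA _ (fun u v => diff_e k (u, v) ^+ 2)) /= -big_split /=.
apply: le_trans (ler_sum _ (fun u _ => hz u)) _.
rewrite big_split /= sumr_const card_ord.
have -> : ((1 / 2 + n%:R) * (1 / 4) ^+ k) *+ (Zp_trunc n).+2 =
   n%:R * ((1 / 2 + n%:R) * (1 / 4) ^+ k) :> R by rewrite -[LHS]mulr_natl (Zp_cast n1).
rewrite (sum_Z_nat (fun u => if u != 0%N then eigA n u ^+ (2 * k) / 2 else 0)).
rewrite [X in X + _ <= _]big_ltn ?(ltnW n1) //= add0r.
rewrite (_ : \sum_(1 <= u < n) _ = 1 / 2 * \sum_(1 <= u < n) eigA n u ^+ (2 * k)).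
  rewrite lerD2l mulrA ler_wpM2r //.
  have : (1 : R) <= n%:R by rewrite ler1n ltnW.
  nra.
rewrite mulr_sumr; apply: eq_big_nat => u /andP[u0 _].
by rewrite -lt0n u0 mulrC mul1r.
Qed.

Lemma tv_dist_le k (T : R) : (0 < k)%N -> 0 < T ->
  \sum_w diff_e k w ^+ 2 + \sum_d diff_E k d ^+ 2 <= 2 * T ^+ 2 ->
  (tv_dist (convpow (@nu_walk R n) k) (@haar R n) <= T%:E)%E.
Proof.
move=> k0 T0 kT; apply: ge_ereal_sup => _ [p hp <-]; rewrite lee_fin.
rewrite convpow_sub_haar //.
exact: real_spec_proj_le (diff_sum0 k0) kT hp.
Qed.

(** The powers of B cancel in [diff_e + diff_E], and the frequencies 1 and -1 both give the k-th
    power of [eigA n 1]. *)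
Lemma tv_dist_ge k : (0 < k)%N ->
  ((eigA n 1 ^+ k / 2 : R)%:E <= tv_dist (convpow (@nu_walk R n) k) (@haar R n))%E.
Proof.
move=> k0; have [p hp] := real_spec_proj_ge n1 (diff_sum0 k0).
have u1 : nat_of_ord (1 : Z) = 1%N by rewrite /= modn_small.
have uN1 : nat_of_ord (- 1 : Z) = (n - 1)%N.
  rewrite /= modn_small // modn_small ?subSS ?subn0; have := Zp_cast n1; lia.
have one0 : (1 : Z) != 0 by apply: contra_eq_neq u1 => ->.
have lam (u : Z) : u != 0 -> diff_e k (u, 0) + diff_E k u = eigA n u ^+ k.
  by move=> u0; rewrite diff_eE // diff_EE // u0 !mul1r; field.
rewrite !lam ?oppr_eq0 // u1 uN1.
have -> : eigA n (n - 1) = eigA n 1 :> R by rewrite /eigA rootcosC // ltnW.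
rewrite -convpow_sub_haar // => h.
apply: (@le_trans _ _ (normc (convpow (@nu_walk R n) k p - haar p))%:E).
  by rewrite lee_fin; apply: le_trans h; lra.
by apply: ereal_sup_ubound; exists p.
Qed.

End Distance.

Theorem proposition4p3 (R : realType) :
  exists c : nat -> R,
    c n @[n --> within (fun n : nat => odd n) \oo] --> (1 : R) /\
    forall (n : nat) (alpha : R) (k : nat),
      odd n -> (3 <= n)%N -> 1 / 20%:R < alpha ->
      (0 < k)%N -> k%:R = alpha * n%:R ^+ 2 ->
      ((1 / 2 * expR (- (alpha * pi ^+ 2 / 2)))%:E
         <= tv_dist (convpow (@nu_walk R n) k) (@haar R n))%E /\
      (tv_dist (convpow (@nu_walk R n) k) (@haar R n)
         <= (c n * expR (- (alpha * pi ^+ 2 / 4)))%:E)%E.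
Proof.
(* 1350 comes from [quarter_pow_le]; [harmonic n] is 1 / (n + 1), which dominates 1 / n^2 for n >=
   3. *)
exists (fun n => 1 + 1350 * harmonic n); split.
  have lim : 1 + 1350 * harmonic n @[n --> \oo] --> (1 + 1350 * 0 : R).
    by apply: cvgD; [exact: cvg_cst | apply: cvgMr; exact: cvg_harmonic].
  by rewrite mulr0 addr0 in lim; exact: cvg_within_filter.
move=> n alpha k _ n3 a20 k0 kE; have n1 : (1 < n)%N by exact: ltnW.
have nR : (3 : R) <= n%:R by rewrite ler_nat.
split.
  apply: le_trans (tv_dist_ge n1 k0); rewrite lee_fin mulrC mul1r ler_wpM2r //.
  have -> : - (alpha * pi ^+ 2 / 2) = - (pi ^+ 2 / (2 * n%:R ^+ 2)) * k%:R.
    by rewrite kE; field; lra.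
  by rewrite expRM_natr lerXn2r ?nnegrE ?expR_ge0 ?eigA_ge0 // eigA1_ge.
have h3 : (n%:R ^+ 2)^-1 <= harmonic n :> R.
  rewrite /= lef_pV2 ?posrE ?ltr0n ?exprn_gt0 ?ltr0n //; last exact: ltnW.
  by rewrite -(natr1 n); nra.
move: (harmonic_ge0 n : 0 <= harmonic n :> R) h3; set h : R := harmonic n => h0 h3.
apply: (tv_dist_le n1 k0).
  by apply: mulr_gt0; [lra | exact: expR_gt0].
apply: le_trans (diff_energy_le n1 k0) _.
have h1 := sum_eigA_pow_le n3 a20 kE.
have h2 := quarter_pow_le n3 a20 kE.
rewrite [X in _ <= _ * X]exprMn (_ : expR (- (alpha * pi ^+ 2 / 4)) ^+ 2 =
  expR (- (alpha * pi ^+ 2 / 2))); last first.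
  by rewrite -expRM_natr; congr expR; field.
move: h1 h2; set E := expR _ => h1 h2.
have E0 : 0 <= E by exact: expR_ge0.
(* The energy is at most 2 E (1 + 1350 / n^2), to be compared with 2 E times the square of the
   constant. *)
have h4 : 1 + 1350 / n%:R ^+ 2 <= (1 + 1350 * h) ^+ 2 by nra.
have := ler_wpM2l E0 h4.
lra.
Qed.
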